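(* Let $\Sigma=(X,\mathcal{D},\phi)$ be a system that is robustly forward complete and for which $0$ is a robust equilibrium point. Suppose there is a continuous function $V:X\to\mathbb{R}_+$ with $V(0)=0$, a function $\psi_2\in\mathcal{K}_\infty$, and a continuous positive definite function $\alpha:\mathbb{R}_+\to\mathbb{R}_+$ (i.e. $\alpha(0)=0$ and $\alpha(r)>0$ for $r>0$) such that $0<V(x)\le\psi_2(\|x\|_X)$ for all $x\in X\setminus\{0\}$ and $\dot V_d(x)\le-\alpha(\|x\|_X)$ for all $x\in X$ and $d\in\mathcal{D}$. Then $0$ is (locally) uniformly asymptotically stable (UAS) for $\Sigma$.
   Context: Notation: $\mathbb{R}_+=[0,\infty)$. $\mathcal{K}$ is the set of continuous strictly increasing $\gamma:\mathbb{R}_+\to\mathbb{R}_+$ with $\gamma(0)=0$; $\mathcal{K}_\infty$ is the set of unbounded $\gamma\in\mathcal{K}$; $\mathcal{L}$ is the set of continuous decreasing $\gamma:\mathbb{R}_+\to\mathbb{R}_+$ with $\lim_{t\to\infty}\gamma(t)=0$; $\mathcal{KL}$ is the set of $\beta:\mathbb{R}_+^2\to\mathbb{R}_+$ with $\beta(\cdot,t)\in\mathcal{K}$ for all $t\ge0$ and $\beta(r,\cdot)\in\mathcal{L}$ for all $r>0$. System: A (forward complete dynamical) system $\Sigma=(X,\mathcal{D},\phi)$ consists of a normed linear space $(X,\|\cdot\|_X)$, a set $D$ of disturbance values (a nonempty subset of a normed linear space), a set $\mathcal{D}$ of functions $d:\mathbb{R}_+\to D$, and a map $\phi:\mathbb{R}_+\times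 X\times\mathcal{D}\to X$ (defined everywhere). $\mathcal{D}$ is shift-invariant ($d\in\mathcal{D}$, $\tau\ge0$ imply $d(\cdot+\tau)\in\mathcal{D}$) and closed under concatenation (for $d_1,d_2\in\mathcal{D}$, $t>0$, the function equal to $d_1(\tau)$ for $\tau\in[0,t]$ and $d_2(\tau-t)$ for $\tau>t$ is in $\mathcal{D}$). Moreover: $\phi(0,x,d)=x$ for all $x,d$; causality: if $d(s)=\tilde d(s)$ for all $s\in[0,t]$ then $\phi(t,x,d)=\phi(t,x,\tilde d)$; for each $(x,d)$ the map $t\mapsto\phi(t,x,d)$ is continuous; cocycle property: $\phi(h,\phi(t,x,d),d(t+\cdot))=\phi(t+h,x,d)$ for all $t,h\ge0$, $x\in X$, $d\in\mathcal{D}$. Robustly forward complete (RFC): for all $C>0,\tau>0$, $\sup\{\|\phi(t,x,d)\|_X : \|x\|_X\le C,\ t\in[0,\tau],\ d\in\mathcal{D}\}<\infty$. Robust equilibrium point: $\phi(t,0,d)=0$ for all $t\ge0,d\in\mathcal{D}$, and for all $\varepsilon>0,h>0$ there is $\delta>0$ such that $\|x\|_X\le\delta$, $t\in[0,h]$, $d\in\mathcal{D}$ imply $\|\phi(t,x,d)\|_X\le\varepsilon$. Dini derivative along trajectories: $\dot V_d(x):=\liminf_{t\to+0}\frac1t\big(V(\phi(t,x,d))-V(x)\big)$. UAS: there exist $\beta\in\mathcal{KL}$ and $r>0$ such that $\|\phi(t,x,d)\|_X\le\beta(\|x\|_X,t)$ for all $x\in X$ with $\|x\|_X<r$, all $d\in\mathcal{D}$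 and $t\ge0$. *)

(* Defs.v *)
From HB Require Import structures.
From mathcomp Require Import all_boot all_order all_algebra.
From mathcomp Require Import all_classical all_reals all_analysis.

Set Implicit Arguments.
Unset Strict Implicit.
Unset Printing Implicit Defensive.

Import Order.TTheory GRing.Theory Num.Theory.
Import numFieldNormedType.Exports.

Local Open Scope classical_set_scope.
Local Open Scope ring_scope.

(* A function on R_+ = [0, +oo[ is represented by a function on R of which only
   the values on [0, +oo[ are ever used. *)

Section comparison_functions.
Variable R : realType.
Implicit Types (g : R -> R) (b : R -> R -> R).

Definition continuous_nneg (T : topologicalType) (f : R -> T) : Prop :=
  {within `[0, +oo[, continuous f}.

Definition classK g : Prop :=
  [/\ continuous_nneg g,
      forall r, 0 <= r -> 0 <= g r,
      forall r s, 0 <= r -> r < s -> g r < g s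
    & g 0 = 0].

Definition classKinf g : Prop :=
  classK g /\ (forall M : R, exists2 r : R, 0 <= r & M < g r).

(* "Decreasing" is read strictly; this is why [classKL] has to leave out r = 0,
   where b 0 is the zero function. *)
Definition classL g : Prop :=
  [/\ continuous_nneg g,
      forall t, 0 <= t -> 0 <= g t,
      forall s t, 0 <= s -> s < t -> g t < g s
    & g t @[t --> +oo] --> (0 : R)].

Definition classKL b : Prop :=
  (forall t, 0 <= t -> classK (fun r => b r t)) /\
  (forall r, 0 < r -> classL (b r)).

Definition posdef g : Prop := g 0 = 0 /\ (forall r, 0 < r -> 0 < g r).

End comparison_functions.

Section systems.
Variables (R : realType) (X U : normedModType R).

Definition shift_dist (tau : R) (d : R -> U) : R -> U := fun s => d (s + tau).

Definition concat_dist (t : R) (d1 d2 : R -> U) : R -> U :=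
  fun s => if s <= t then d1 s else d2 (s - t).

(* [dist_ext] makes [dist] a set of functions on R_+: membership does not
   depend on the values at negative times.  [flow] is total, but is constrained
   and used only at nonnegative times and for disturbances in [dist]. *)
Record system := System {
  dist_val : set U;
  dist : set (R -> U);
  flow : R -> X -> (R -> U) -> X;
  dist_val_neq0 : dist_val !=set0;
  dist_valued : forall d, dist d -> forall s, 0 <= s -> dist_val (d s);
  dist_ext : forall d d', dist d ->
    (forall s, 0 <= s -> d s = d' s) -> dist d';
  dist_shift : forall d tau, dist d -> 0 <= tau -> dist (shift_dist tau d);
  dist_concat : forall d1 d2 t, dist d1 -> dist d2 -> 0 < t ->
    dist (concat_dist t d1 d2);
  flow0 : forall x d, dist d -> flow 0 x d = x;
  flow_causal : forall t x d d', 0 <= t -> dist d -> dist d' ->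
    (forall s, 0 <= s <= t -> d s = d' s) -> flow t x d = flow t x d';
  flow_continuous : forall x d, dist d ->
    continuous_nneg (fun t => flow t x d);
  flow_cocycle : forall t h x d, 0 <= t -> 0 <= h -> dist d ->
    flow h (flow t x d) (shift_dist t d) = flow (t + h) x d
}.

Definition robustly_forward_complete (S : system) : Prop :=
  forall C tau : R, 0 < C -> 0 < tau ->
    (ereal_sup [set y : \bar R | exists (x : X) (t : R) (d : R -> U),
       [/\ `|x| <= C, 0 <= t <= tau, dist S d
         & y = `|flow S t x d|%:E]]%R < +oo)%E.

Definition robust_equilibrium0 (S : system) : Prop :=
  (forall t d, 0 <= t -> dist S d -> flow S t 0 d = 0) /\
  (forall eps h : R, 0 < eps -> 0 < h ->
     exists2 delta : R, 0 < delta &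
       forall x t d, `|x| <= delta -> 0 <= t <= h -> dist S d ->
         `|flow S t x d| <= eps).

(* Lower right Dini derivative, possibly infinite. *)
Definition dini_derivative (S : system) (V : X -> R) (d : R -> U) (x : X)
    : \bar R :=
  limf_einf (fun t : R => (t^-1 * (V (flow S t x d) - V x))%:E) 0^'+.

Definition UAS (S : system) : Prop :=
  exists (beta : R -> R -> R) (r : R),
    [/\ classKL beta, 0 < r
      & forall x d t, `|x| < r -> dist S d -> 0 <= t ->
          `|flow S t x d| <= beta `|x| t].

End systems.

(* Main.v *)
Require Import Defs.
From HB Require Import structures.
From mathcomp Require Import all_boot all_order all_algebra.
From mathcomp Require Import all_classical all_reals all_analysis.
From mathcomp Require Import lra.

(** The function [V] may be arbitrarily small at points far from the
    equilibrium, so its sublevel sets say nothing about the norm and the usual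
    proof of stability is not available.  What replaces coercivity is time.

    Along a trajectory [V] decreases at a rate at least [alpha] of the norm
    ([flow_decay]).  Suppose a trajectory starts very close to [0] and later
    leaves the ball of radius [e].  Look at the last time [a] before that at
    which it is in a much smaller ball of radius [de].  Robustness of the
    equilibrium forces it to remain in the [e]-ball up to time [a + 2], hence
    from [a] to [a + 2] it moves in the annulus [de <= norm <= e], on which
    [alpha] has a positive minimum [m].  So [V]
    drops by at least [m] between [a + 1] and [a + 2]; but at the start it was
    at most [psi2] of a tiny number, less than [m], and it cannot become
    negative.  This is uniform stability ([lyapunov_stable]).

    Once trajectories starting in the [r]-ball are known to be bounded by [B],
    the same budget gives attraction: a trajectory cannot remain outside the
    [eta]-ball for longer than [psi2 r] divided by the minimum of [alpha]
    between [eta] and [B], and after its visit to the [eta]-ball stability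
    keeps it small ([lyapunov_attractive]).

    It remains to turn uniform stability and uniform attraction into one [KL]
    bound ([UAS_of_stable_attractive]).  For starting points in the [r]-ball,
    stability yields a class [K] function [s] with norm at most [s `|x|] at all
    times, and attraction yields a decreasing function [l], tending to [0], with
    norm at most [l t] at time [t]; the geometric mean [sqrt (s `|x| * l t)] of
    the two bounds is a [KL] bound.  Both come from one construction of strictly
    decreasing continuous majorants ([decreasing_majorant]), since a class [K]
    majorant near [0] is a decreasing majorant at infinity after the
    substitution [r |-> r^-1]. *)

Set Implicit Arguments.
Unset Strict Implicit.
Unset Printing Implicit Defensive.

Import Order.TTheory GRing.Theory Num.Theory.
Import numFieldNormedType.Exports.

Local Open Scope classical_set_scope.
Local Open Scope ring_scope.

(** * Dini derivatives and decrease *)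

Section dini.
Variable R : realType.
Implicit Types (f : R -> R) (a b c : R).

Lemma last_time_le f a b y : a <= b -> {within `[a, b], continuous f} ->
  f a <= y ->
  exists t, [/\ a <= t, t <= b, f t <= y & forall s, t < s -> s <= b -> y < f s].
Proof.
move=> ab cf fay.
have clA : closed (`[a, b] `&` f @^-1` [set z | z <= y]).
  have /continuous_closedP/(_ _ (@closed_le _ y))/closed_subspaceP[V clV e] := cf.
  by rewrite setIC -e; apply: closedI => //; exact: itv_closed.
set A := (X in closed X) in clA.
have A0 : A !=set0 by exists a; split=> //=; rewrite in_itv /= lexx.
have ubA : has_ubound A by exists b => t [/=]; rewrite in_itv /= => /andP[].
have [] : A (sup A) by apply: clA; exact: closure_sup.
rewrite /= in_itv /= => /andP[at_ tb] fty.
exists (sup A); split=> // s ts sb; rewrite ltNge; apply/negP => fsy.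
have /(ub_le_sup ubA) : A s.
  by split=> //=; rewrite in_itv /= sb (le_trans at_ (ltW ts)).
by rewrite leNgt ts.
Qed.

(** The hypothesis says that the lower right Dini derivative is at most [c] on
    [a <= s < b].  For [k > c], consider the line of slope [k] that meets the
    graph of [f] at [a].  From the last time at which [f] does not exceed it, all
    slopes of [f] up to [b] would be larger than [k]; so that time is [b]. *)
Lemma dini_le_slope f a b c : a <= b -> {within `[a, b], continuous f} ->
  (forall s k e, a <= s -> s < b -> c < k -> 0 < e ->
     exists h, [/\ 0 < h, h < e & f (s + h) - f s < k * h]) ->
  f b - f a <= c * (b - a).
Proof.
move=> ab cf Df; apply/ler_addgt0Pr => e e0.
(* The excess of [k] over [c] costs at most [e] on an interval of length
   [b - a]; the summand [1] covers the case [a = b]. *)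
pose k := c + e / (b - a + 1).
have ba1 : 0 < b - a + 1 by lra.
have ck : c < k by rewrite ltrDl divr_gt0.
have kle : k * (b - a) <= c * (b - a) + e.
  rewrite mulrDl lerD2l -mulrA; apply: ler_piMr; first exact: ltW.
  by rewrite mulrC ler_pdivrMr //; lra.
apply: le_trans kle.
pose g t := f t - k * (t - a).
have cg : {within `[a, b], continuous g}.
  have ch : {within `[a, b], continuous (fun t : R => k * (t - a))}.
    apply: continuous_subspaceT => t.
    by apply: cvgM; [exact: cvg_cst|apply: cvgB; [exact: cvg_id|exact: cvg_cst]].
  by move=> t; apply: cvgB; [exact: cf|exact: ch].
have [t [at_ tb gt gs]] := last_time_le ab cg (lexx (g a)).
have [<-|/eqP tneb] := eqVneq t b; first by move: gt; rewrite /g subrr; lra.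
have {tneb} tltb : t < b by rewrite lt_neqAle tb andbT; apply/eqP.
have [h [h0 hb fh]] := Df t k (b - t) at_ tltb ck ltac:(lra).
have := gs (t + h) ltac:(lra) ltac:(lra).
by move: gt; rewrite /g subrr; lra.
Qed.

(** A lower limit only controls [f] along some sequence tending to [0]: this is
    why the conclusion is existential, and it suffices for [dini_le_slope]. *)
Lemma limf_einf_right_lt f c k e : (limf_einf (EFin \o f) 0^'+ <= c%:E)%E ->
  c < k -> 0 < e -> exists h, [/\ 0 < h, h < e & f h < k].
Proof.
move=> fc ck e0; apply: contrapT => noh.
suff : (k%:E <= limf_einf (EFin \o f) 0^'+)%E.
  by move=> /le_trans/(_ fc); rewrite lee_fin leNgt ck.
rewrite limf_einfE; apply: ereal_sup_ge.
exists (ereal_inf ((EFin \o f) @` [set h | 0 < h < e])).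
  exists [set h | 0 < h < e] => //.
  near=> h; apply/andP; split; near: h; [exact: nbhs_right_gt|exact: nbhs_right_lt].
apply: le_ereal_inf_tmp => _ [h /andP[h0 he] <-]; rewrite lee_fin leNgt.
by apply/negP => fh; apply: noh; exists h.
Unshelve. all: by end_near. Qed.

End dini.

(** * Comparison functions as majorants *)

Section majorants.
Variable R : realType.

(** The quantities to be majorized are given by a relation: [M t y] says that
    the value [y] occurs at time [t]. *)
Definition le_after (M : R -> R -> Prop) (e T : R) :=
  forall t y, T <= t -> M t y -> y <= e.

Definition decay_profile (l : R -> R) := [/\ continuous l, forall t, 0 < l t,
  forall s t, s < t -> l t < l s & l t @[t --> +oo] --> 0].

(** Values bounded by [B] that are at most [e] after time [T] are majorized by
    the function [e + max 0 (B + T - t)], which is nonincreasing and has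
    Lipschitz constant [1].  These properties pass to the infimum over all pairs
    [(e, T)], which tends to [0]; adding [expR (- t)] makes it strictly
    decreasing and positive. *)
Lemma decreasing_majorant (M : R -> R -> Prop) (B : R) :
  (forall t y, M t y -> y <= B) ->
  (forall e, 0 < e -> exists T, le_after M e T) ->
  exists2 l : R -> R, decay_profile l & forall t y, M t y -> y <= l t.
Proof.
move=> MB Mv.
pose E t := [set z | exists e T, [/\ 0 < e, le_after M e T &
   z = e + Num.max 0 (B + T - t)]].
have E0 t : E t !=set0.
  by have [T vT] := Mv 1 ltr01; exists (1 + Num.max 0 (B + T - t)), 1, T.
have lbE t : lbound (E t) 0.
  by move=> _ [e [T [e0 _ ->]]]; apply: addr_ge0; [exact: ltW|rewrite le_max lexx].
have hlE t : has_lbound (E t) by exists 0.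
pose L t := inf (E t).
have Lge0 t : 0 <= L t by exact: lb_le_inf.
have Lni s t : s <= t -> L t <= L s.
  move=> st; apply: lb_le_inf => // _ [e [T [e0 vT ->]]].
  apply: (@le_trans _ _ (e + Num.max 0 (B + T - t))).
    by apply: ge_inf => //; exists e, T.
  by rewrite lerD2l ge_max !le_max lexx /=; apply/orP; right; lra.
have Llip s t : s <= t -> L s <= L t + (t - s).
  move=> st; rewrite -lerBlDr; apply: lb_le_inf => // _ [e [T [e0 vT ->]]].
  rewrite lerBlDr; apply: (@le_trans _ _ (e + Num.max 0 (B + T - s))).
    by apply: ge_inf => //; exists e, T.
  rewrite -[leRHS]addrA lerD2l ge_max.
  rewrite -!lerBlDr !le_max.
  by apply/andP; split; apply/orP; [left|right]; lra.
have cL : continuous L.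
  move=> t; apply/cvgrPdist_le => e e0; near=> s.
  have : `|t - s| <= e by near: s; apply: cvgr_dist_le => //; exact: cvg_id.
  rewrite !ler_norml => /andP[h1 h2]; apply/andP.
  have [st|ts] := leP s t.
    by have := Lni _ _ st; have := Llip _ _ st; split; lra.
  by have := Lni _ _ (ltW ts); have := Llip _ _ (ltW ts); split; lra.
have cvL : L t @[t --> +oo] --> 0.
  apply/cvgrPdist_le => e e0; have [T vT] := Mv e e0.
  near=> t; rewrite sub0r normrN ger0_norm //.
  apply: (@le_trans _ _ (e + Num.max 0 (B + T - t))).
    by apply: ge_inf => //; exists e, T.
  rewrite gerDl ge_max lexx /= subr_le0; near: t.
  exact: nbhs_pinfty_ge (num_real _).
have ML t y : M t y -> y <= L t.
  move=> My; apply: lb_le_inf => // _ [e [T [e0 vT ->]]].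
  have [Tt|tT] := leP T t.
    by rewrite (le_trans (vT _ _ Tt My)) // lerDl le_max lexx.
  rewrite (le_trans (MB _ _ My)) // -lerBlDl le_max; apply/orP; right; lra.
exists (fun t => L t + expR (- t)); last first.
  by move=> t y /ML yL; rewrite (le_trans yL) // lerDl expR_ge0.
split.
- move=> t; apply: cvgD; first exact: cL.
  apply: (@continuous_comp _ _ _ (fun s : R => - s) expR).
    by apply: cvgN; exact: cvg_id.
  exact: continuous_expR.
- by move=> t; rewrite ltr_wpDl ?expR_gt0.
- by move=> s t st; rewrite ler_ltD ?Lni ?ltW // ltr_expR ltrN2.
- by rewrite -[X in _ --> X]addr0; apply: cvgD => //; exact: cvgr_expR.
Unshelve. all: by end_near. Qed.

Definition inv_at0 (l : R -> R) (r : R) : R := if r <= 0 then 0 else l r^-1.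

(** Inversion reverses the order, and the limit of [l] at infinity becomes
    continuity at [0]. *)
Lemma inv_at0_classK (l : R -> R) : decay_profile l -> classK (inv_at0 l).
Proof.
move=> [cl l0 ld lv].
have g0 r : 0 <= inv_at0 l r by rewrite /inv_at0; case: ifP => // _; exact: ltW.
split=> // [|r s r0 rs|]; last by rewrite /inv_at0 lexx.
- apply/continuous_within_itvcyP; split=> [r|].
    rewrite in_itv /= andbT => r0.
    have cli : {for r, continuous (l \o @GRing.inv R)}.
      apply: continuous_comp; last exact: cl.
      by apply: inv_continuous; rewrite gt_eqF.
    apply: cvg_trans; last (rewrite /inv_at0 leNgt r0 /=; exact: cli).
    apply: near_eq_cvg; near=> s.
    rewrite /inv_at0 leNgt ifF //; apply/negbF; near: s.
    exact: lt_nbhsr.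
  rewrite {2}/inv_at0 lexx.
  apply/cvgrPdist_le => e e0.
  have /cvgrPdist_le/(_ e e0)[T [_ hT]] := lv.
  near=> r.
  have r0 : 0 < r by near: r; exact: nbhs_right_gt.
  rewrite /inv_at0 [r <= 0]leNgt r0 /=; apply: hT.
  apply: (@le_lt_trans _ _ (Num.max T 1)); first by rewrite le_max lexx.
  rewrite -[ltLHS]invrK ltf_pV2 ?posrE ?invr_gt0 ?lt_max ?ltr01 ?orbT //.
  by near: r; apply: nbhs_right_lt; rewrite invr_gt0 lt_max ltr01 orbT.
- have s0 : 0 < s by lra.
  rewrite /inv_at0 [s <= 0]leNgt s0 /=; case: ifPn => [_|]; first exact: l0.
  by rewrite -ltNge => r0'; apply: ld; rewrite ltf_pV2.
Unshelve. all: by end_near. Qed.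

Lemma classK_classL_sqrt (s l : R -> R) : classK s -> decay_profile l ->
  classKL (fun r t => Num.sqrt (s r * l t)).
Proof.
move=> [cs s0 si sz] [cl l0 ld lv]; split.
  move=> t t0; split=> [|r r0|r q r0 rq|].
  - move=> r; have cst : {within `[0, +oo[, continuous (fun r => s r * l t)}.
      by move=> q; apply: cvgM; [exact: cs|exact: cvg_cst].
    exact: (continuous_comp (cst r) (@sqrt_continuous _ _)).
  - exact: sqrtr_ge0.
  - by rewrite ltr_sqrt ?mulr_gt0 ?ltr_pM2r ?si // (le_lt_trans (s0 _ r0)) ?si.
  - by rewrite sz mul0r sqrtr0.
move=> r r0.
have sr0 : 0 < s r by rewrite -sz si.
split=> [|t t0|t u t0 tu|].
- apply: continuous_subspaceT => t.
  apply: (@continuous_comp _ _ _ (fun t => s r * l t) Num.sqrt).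
    by apply: cvgM; [exact: cvg_cst|exact: cl].
  exact: sqrt_continuous.
- exact: sqrtr_ge0.
- by rewrite ltr_sqrt ?mulr_gt0 // ltr_pM2l // ld.
- rewrite -[X in _ --> X](@sqrtr0 R) -[X in _ --> Num.sqrt X](mulr0 (s r)).
  have cv : s r * l t @[t --> +oo] --> s r * 0.
    by apply: cvgM => //; exact: cvg_cst.
  exact: cvg_comp cv (@sqrt_continuous _ _).
Qed.

End majorants.

(** * Decrease along trajectories, stability and attraction *)

Section lyapunov.
Variables (R : realType) (X U : normedModType R) (S : system X U).

Definition stable0 := forall e, 0 < e -> exists2 eta, 0 < eta &
  forall x t d, `|x| <= eta -> 0 <= t -> dist S d -> `|flow S t x d| <= e.

Definition attractive_from (r : R) := forall e, 0 < e -> exists T,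
  forall x t d, `|x| <= r -> T <= t -> 0 <= t -> dist S d ->
    `|flow S t x d| <= e.

Variables (V : X -> R) (alpha : R -> R).
Hypothesis V_cont : continuous V.
Hypothesis V_dini : forall (x : X) (d : R -> U), dist S d ->
  (dini_derivative S V d x <= (- alpha `|x|)%:E)%E.

(** By the cocycle property, the Dini derivative of [V] along the trajectory at
    time [s] is the one at the point reached, for the shifted disturbance. *)
Lemma flow_decay x d a b m : dist S d -> 0 <= a -> a <= b ->
  (forall s, a <= s -> s < b -> m <= alpha `|flow S s x d|) ->
  V (flow S b x d) <= V (flow S a x d) - m * (b - a).
Proof.
move=> dd a0 ab ma.
have cf : {within `[a, b], continuous (fun t => V (flow S t x d))}.
  have cF : {within `[a, b], continuous (fun t => flow S t x d)}.
    apply: (continuous_subspaceW _ (@flow_continuous _ _ _ S x d dd)) => t /=.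
    by rewrite !in_itv /= andbT => /andP[/(le_trans a0)].
  by move=> t; exact: (continuous_comp (cF t) (@V_cont _)).
have := @dini_le_slope R _ a b (- m) ab cf.
rewrite mulNr lerBlDr addrC; apply => s k e sa sb mk e0.
have s0 : 0 <= s by exact: le_trans sa.
have ds : dist S (shift_dist s d) by exact: dist_shift.
have dk : - alpha `|flow S s x d| < k.
  by rewrite (le_lt_trans _ mk) // lerN2 ma.
have [h [h0 he]] := limf_einf_right_lt (V_dini (flow S s x d) ds) dk e0.
rewrite /= flow_cocycle ?(ltW h0) // ltr_pdivrMl // => hk.
by exists h; split=> //; rewrite mulrC.
Qed.

Hypothesis alpha_cont : continuous_nneg alpha.
Hypothesis alpha_posdef : posdef alpha.

Lemma posdef_min_annulus (a b : R) : 0 < a -> a <= b ->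
  exists2 m, 0 < m & forall r, a <= r -> r <= b -> m <= alpha r.
Proof.
move=> a0 ab; have ca : {within `[a, b], continuous alpha}.
  apply: (continuous_subspaceW _ alpha_cont) => t /=.
  by rewrite !in_itv /= andbT => /andP[/(le_trans (ltW a0))].
have [c] := EVT_min ab ca; rewrite in_itv /= => /andP[ac _] cmin.
exists (alpha c); first by apply: alpha_posdef.2; exact: lt_le_trans ac.
by move=> r ar rb; apply: cmin; rewrite in_itv /= ar.
Qed.

Lemma alpha_norm_ge0 (x : X) : 0 <= alpha `|x|.
Proof.
have [->|x0] := eqVneq x 0; first by rewrite normr0 alpha_posdef.1.
by apply/ltW/alpha_posdef.2; rewrite normr_gt0.
Qed.

Lemma flow_nonincreasing x d a b : dist S d -> 0 <= a -> a <= b ->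
  V (flow S b x d) <= V (flow S a x d).
Proof.
move=> dd a0 ab; have := @flow_decay x d a b 0 dd a0 ab.
by rewrite mul0r subr0; apply => s _ _; exact: alpha_norm_ge0.
Qed.

Hypothesis V_ge0 : forall x : X, 0 <= V x.
Variable psi2 : R -> R.
Hypothesis psi2_K : classK psi2.
Hypothesis V_le : forall x, V x <= psi2 `|x|.

Lemma classK_small (m : R) : 0 < m ->
  exists2 e, 0 < e & forall r, 0 <= r -> r <= e -> psi2 r < m.
Proof.
move=> m0; have [/continuous_within_itvcyP[_ c0] _ si sz] := psi2_K.
have [e /= e0 he] : \forall r \near 0^'+, psi2 r < m.
  by apply: cvgr_lt c0 _ _; rewrite sz.
exists (e / 2); first by rewrite divr_gt0.
move=> r; rewrite le_eqVlt => /predU1P[<-|r0] re; first by rewrite sz.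
by apply: he => //=; rewrite sub0r normrN gtr0_norm //; lra.
Qed.

(** Leaving the [e]-ball takes a time at least [2] spent between the radii
    [de] and [e], which consumes more of [V] than a trajectory starting near
    [0] has. *)
Lemma lyapunov_stable : robust_equilibrium0 S -> stable0.
Proof.
move=> [_ S_eq] e e0.
have [d0 d0_gt0 hd] := S_eq e 2 e0 ltac:(lra).
pose de := Num.min d0 e.
have de0 : 0 < de by rewrite lt_min d0_gt0.
have [m m0 hm] := @posdef_min_annulus de e de0 ltac:(by rewrite ge_min lexx orbT).
have [c c0 hc] := classK_small m0.
exists (Num.min c de); first by rewrite lt_min c0.
move=> x t d; rewrite le_min => /andP[xc xde] t0 dd.
rewrite leNgt; apply/negP => flow_gt.
have cn : {within `[0, t], continuous (fun s => `|flow S s x d|)}.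
  have cF : {within `[0, t], continuous (fun s => flow S s x d)}.
    apply: (continuous_subspaceW _ (@flow_continuous _ _ _ S x d dd)) => s /=.
    by rewrite !in_itv /= andbT => /andP[].
  by move=> s; exact: (continuous_comp (cF s) (@norm_continuous _ _ _)).
have [|a [a0 at_ fa fs]] := @last_time_le R _ 0 t de t0 cn.
  by rewrite flow0.
have hda s : 0 <= s -> s <= 2 -> `|flow S (a + s) x d| <= e.
  move=> s0 s2; rewrite -flow_cocycle //; apply: hd.
  - by rewrite (le_trans fa) // ge_min lexx.
  - by rewrite s0.
  - exact: dist_shift.
have a2t : a + 2 < t.
  rewrite ltNge; apply/negP => ta; have := hda (t - a) ltac:(lra) ltac:(lra).
  by rewrite addrC subrK leNgt flow_gt.
(* The decay is measured from [a + 1]: at time [a] itself the norm is at most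
   [de] and the minimum [m] need not bound [alpha] there. *)
have := @flow_decay x d (a + 1) (a + 2) m dd ltac:(lra) ltac:(lra).
have -> : a + 2 - (a + 1) = 1 by lra.
rewrite mulr1 => hdec.
have := V_ge0 (flow S (a + 2) x d); rewrite leNgt => /negP; apply.
apply: le_lt_trans (hdec _) _.
  move=> s as1 s2a; apply: hm; first by apply/ltW/fs; lra.
  by have := hda (s - a) ltac:(lra) ltac:(lra); rewrite addrC subrK.
rewrite subr_lt0; apply: le_lt_trans (hc _ (normr_ge0 x) xc).
apply: le_trans (V_le x); rewrite -{2}(@flow0 _ _ _ S x d dd).
by apply: flow_nonincreasing => //; lra.
Qed.

(** A trajectory that avoids the [eta]-ball loses [V] at a rate at least [m],
    so it has to enter that ball before the initial budget [psi2 r] is spent;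
    from the entrance on, stability applies to the shifted disturbance. *)
Lemma lyapunov_attractive (r B : R) : stable0 ->
  (forall x t d, `|x| <= r -> 0 <= t -> dist S d -> `|flow S t x d| <= B) ->
  attractive_from r.
Proof.
move=> stab bnd e e0; have [eta eta0 heta] := stab e e0.
(* [B] may be smaller than [eta]; the maximum keeps the annulus nonempty. *)
have [m m0 hm] := @posdef_min_annulus eta (Num.max B eta) eta0
  ltac:(by rewrite le_max lexx orbT).
exists (psi2 r / m + 1) => x t d xr Tt t0 dd.
have [_ psi_ge0 psi_inc _] := psi2_K.
have psi_le : psi2 `|x| <= psi2 r.
  by move: xr; rewrite le_eqVlt => /predU1P[->//|/psi_inc/ltW]; exact.
have [[s [s0 st fs]]|far] :=
    pselect (exists s, [/\ 0 <= s, s <= t & `|flow S s x d| <= eta]).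
  have -> : t = s + (t - s) by rewrite addrC subrK.
  rewrite -flow_cocycle ?subr_ge0 //; apply: heta => //; first by rewrite subr_ge0.
  exact: dist_shift.
have /= := @flow_decay x d 0 t m dd (lexx _) t0 _.
rewrite flow0 // subr0 => dec.
exfalso; have : V (flow S t x d) < 0.
  apply: le_lt_trans (dec _) _.
    move=> s s0 st; apply: hm; last by rewrite le_max bnd.
    rewrite leNgt; apply/negP => fs; apply: far.
    by exists s; split=> //; exact: ltW.
  rewrite subr_lt0 (le_lt_trans (V_le x)) // (le_lt_trans psi_le) //.
  rewrite mulrC -ltr_pdivrMr //; lra.
by rewrite ltNge V_ge0.
Qed.

End lyapunov.

(** * From stability and attraction to a [KL] bound *)

(** Two bounds on the same norm, one depending on the starting point and one
    on time, also bound it by their geometric mean, which is of class [KL]. *)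
Lemma UAS_of_stable_attractive (R : realType) (X U : normedModType R)
    (S : system X U) (r B : R) :
  (forall t d, 0 <= t -> dist S d -> flow S t 0 d = 0) ->
  0 < r ->
  (forall x t d, `|x| <= r -> 0 <= t -> dist S d -> `|flow S t x d| <= B) ->
  stable0 S -> attractive_from S r -> UAS S.
Proof.
move=> eq0 r0 bnd stab attr.
pose Mt t y := exists x d,
  [/\ `|x| <= r, dist S d, 0 <= t & y = `|flow S t x d|].
have [t y [x [d [xr dd t0 ->]]]|e /attr[T hT]|l lp hl] :=
    @decreasing_majorant R Mt B.
- exact: bnd.
- by exists T => t y Tt [x [d [xr dd t0 ->]]]; exact: hT.
(* Stability says that the values indexed by [q = `|x|^-1] vanish as [q] tends
   to infinity. *)
pose Mq q y := exists x d t, [/\ x != 0 /\ `|x| <= r, dist S d, 0 <= t,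
  q = `|x|^-1 & y = `|flow S t x d|].
have [q y [x [d [t [[_ xr] dd t0 _ ->]]]]|e /stab[eta eta0 heta]|k kp hk] :=
    @decreasing_majorant R Mq B.
- exact: bnd.
- exists eta^-1 => q y hq [x [d [t [[x0 _] dd t0 qx ->]]]]; apply: heta => //.
  by move: hq; rewrite qx lef_pV2 ?posrE ?normr_gt0.
exists (fun s t => Num.sqrt (inv_at0 k s * l t)), r; split=> //.
  by apply: classK_classL_sqrt => //; exact: inv_at0_classK.
move=> x d t xr dd t0.
have [->|x0] := eqVneq x 0; first by rewrite eq0 // normr0 sqrtr_ge0.
rewrite -[leLHS]ger0_norm // -sqrtr_sqr ler_wsqrtr // expr2.
apply: ler_pM => //.
  rewrite /inv_at0 normr_le0 (negbTE x0); apply: hk.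
  by exists x, d, t; split=> //; split=> //; exact: ltW.
by apply: hl; exists x, d; split=> //; exact: ltW.
Qed.

Theorem theorem3p6 (R : realType) (X U : normedModType R) (S : system X U)
    (S_rfc : robustly_forward_complete S)
    (S_eq0 : robust_equilibrium0 S)
    (V : X -> R) (psi2 alpha : R -> R)
    (V_cont : continuous V)
    (V_ge0 : forall x : X, 0 <= V x)
    (V0 : V 0 = 0)
    (psi2_Kinf : classKinf psi2)
    (alpha_cont : continuous_nneg alpha)
    (alpha_posdef : posdef alpha)
    (V_bounds : forall x : X, x != 0 -> 0 < V x /\ V x <= psi2 `|x|)
    (V_dini : forall (x : X) (d : R -> U), dist S d ->
      (dini_derivative S V d x <= (- alpha `|x|)%:E)%E) :
  UAS S.
Proof.
have V_le x : V x <= psi2 `|x|.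
  have [->|/V_bounds[]//] := eqVneq x 0.
  by rewrite normr0 V0; case: psi2_Kinf => -[_ _ _ ->].
have stab := lyapunov_stable V_cont V_dini alpha_cont alpha_posdef V_ge0
  psi2_Kinf.1 V_le S_eq0.
have [r r0 bnd] := stab 1 ltr01.
apply: (UAS_of_stable_attractive S_eq0.1 r0 bnd stab).
exact: (lyapunov_attractive V_cont V_dini alpha_cont alpha_posdef V_ge0
  psi2_Kinf.1 V_le stab bnd).
Qed.
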